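(* Let $n\geq 1$, $\lambda\vdash n$, and $\sigma\in\mathfrak{S}_n$. Then (a) $|\mathrm{ch}^\lambda(\sigma)|\leq \ell(\lambda)^{\mathrm{cyc}(\sigma)}$; (b) $|\mathrm{ch}^\lambda(\sigma)|\leq (2\delta(\lambda))^{\mathrm{cyc}(\sigma)}$.
   Context: $\mathfrak{S}_n$ is the symmetric group on $n$ elements. $\mathrm{ch}^\lambda$ is the (unnormalized) character of the irreducible complex representation of $\mathfrak{S}_n$ indexed in the usual way by $\lambda\vdash n$ (with $[n]$ corresponding to the trivial representation). $\ell(\lambda)$ is the number of rows (nonzero parts) of $\lambda$. $\delta(\lambda)=\max\{i\geq 1 : \min(\lambda_i,\lambda_i')\geq i\}$ is the diagonal length of $\lambda$, where $\lambda_i$ and $\lambda'_i$ are the lengths of the $i$-th row and $i$-th column. $\mathrm{cyc}(\sigma)$ is the total number of cycles of $\sigma$, fixed points included. *)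

(* Defs.v *)
From HB Require Import structures.
From mathcomp Require Import all_boot all_order all_algebra all_fingroup.
From mathcomp Require Import all_field all_character.

Set Implicit Arguments.
Unset Strict Implicit.
Unset Printing Implicit Defensive.

Import Order.TTheory GRing.Theory Num.Theory.
Local Open Scope ring_scope.

(* Partitions are the sequences of their nonzero parts, so the number of rows
   is [size lam].  Indices of rows and columns start at 0. *)
Definition is_partition (n : nat) (lam : seq nat) : bool :=
  [&& sorted geq lam, 0%N \notin lam & sumn lam == n].

Definition row_len (lam : seq nat) (i : nat) : nat := nth 0%N lam i.

Definition col_len (lam : seq nat) (j : nat) : nat :=
  count (fun r => (j < r)%N) lam.

(* An index i satisfying the condition is at most |lam|, so that the range
   below loses nothing. *)
Definition diag_len (lam : seq nat) : nat :=
  (\max_(1 <= i < (sumn lam).+1 | i <= minn (row_len lam i.-1) (col_len lam i.-1))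
     i)%N.

Definition ncycles (n : nat) (s : {perm 'I_n}) : nat := #|porbits s|.

Section Specht.

Variables (n : nat) (lam : seq nat).

(* The stabilisers of the rows and of the columns of the tableau of shape lam
   filled with 0, 1, ..., n - 1 row after row: its entry k lies in row
   [reshape_index lam k] and column [reshape_offset lam k]. *)
Definition row_stab : {set {perm 'I_n}} :=
  [set p : {perm 'I_n} |
    [forall k, reshape_index lam (p k) == reshape_index lam k]].

Definition col_stab : {set {perm 'I_n}} :=
  [set q : {perm 'I_n} |
    [forall k, reshape_offset lam (q k) == reshape_offset lam k]].

Let G : {group {perm 'I_n}} := [set: {perm 'I_n}]%G.

(* The Young symmetrizer: [gring_row (aG g)] is the row vector of the group
   element g in the (right) regular representation. *)
Definition young_symmetrizer : 'rV[algC]_(gcard G) :=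
  \sum_(p in row_stab) \sum_(q in col_stab)
    (-1) ^+ odd_perm q *: gring_row (regular_repr algC G (p * q)%g).

(* The Specht module, i.e., the right ideal of the group algebra generated by
   the Young symmetrizer.  The choice of right rather than left modules has no
   effect on characters: permutations are conjugate to their inverses. *)
Definition specht_mx := cyclic_mx (regular_repr algC G) young_symmetrizer.

Definition specht_repr :=
  submod_repr (cyclic_mx_module (regular_repr algC G) young_symmetrizer).

Definition specht_char : 'CF(G) := cfRepr specht_repr.

End Specht.

(* Main.v *)
(** Let l be the number of rows of lambda, rho = (l-1, ..., 1, 0), and let
    [eta nu] be the permutation character of S_n on the functions from
    {1, ..., n} to {1, ..., l} whose fibres have the sizes nu.  Frobenius'
    formula says that the Specht character is
      psi = \sum_w sgn(w) eta (lambda + rho - w rho).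
    By Burnside's lemma <psi, eta nu> is the coefficient of x^(lambda + rho) in
    the product of the Vandermonde alternant and of the complete symmetric
    functions h_(nu_j); by the Pieri rule it is 1 for nu = lambda and 0 if nu is
    lexicographically larger.  As every other nu occurring in psi is larger than
    lambda, <psi, psi> = 1, so psi is irreducible up to sign.  The Specht
    character is also orthogonal to eta nu for these nu, and is a summand of
    eta lambda; hence its inner product with psi is positive, and it is psi.

    Evaluated at a permutation, psi is a sum, over the assignments of one of the
    l indices to each cycle, of coefficients 0, 1 or -1 of the alternant: this
    is (a).  For (b), the cycles are added one at a time.  A cycle of length k
    subtracts k from one entry of lambda + rho, and the term survives only if
    the entries remain distinct and nonnegative.  Exactly d = delta(lambda)
    entries of lambda + rho are at least l; dually, d elements of [0, l) are not
    entries.  Hence at most d terms survive from entries >= l and at most d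
    from smaller entries, and d does not increase in the process. *)
Require Import Defs.
From mathcomp Require Import all_boot all_order all_algebra all_fingroup.
From mathcomp Require Import all_field all_character.
From mathcomp Require Import zify.
Import Order.TTheory GRing.Theory Num.Theory.
Local Open Scope ring_scope.

Set Implicit Arguments.
Unset Strict Implicit.
Unset Printing Implicit Defensive.

(** * Alternants *)

Section FfunSplit.

Variables (K : finType) (m : nat).

Definition ffun_cons (k : K) (c : {ffun 'I_m -> K}) : {ffun 'I_m.+1 -> K} :=
  [ffun j => oapp c k (unlift ord0 j)].

Lemma ffun_cons0 k c : ffun_cons k c ord0 = k.
Proof. by rewrite ffunE unlift_none. Qed.

Lemma ffun_consS k c j : ffun_cons k c (lift ord0 j) = c j.
Proof. by rewrite ffunE liftK. Qed.

Lemma big_ffun_cons (V : nmodType) (P : pred {ffun 'I_m.+1 -> K}) F :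
  \sum_(c | P c) F c =
  \sum_k \sum_(c | P (ffun_cons k c)) F (ffun_cons k c) :> V.
Proof.
rewrite pair_big_dep /=.
rewrite (reindex (fun p : K * {ffun 'I_m -> K} => ffun_cons p.1 p.2)) //.
exists (fun c : {ffun 'I_m.+1 -> K} => (c ord0, [ffun j => c (lift ord0 j)])).
  move=> [k c] _ /=; rewrite ffun_cons0; congr (_, _).
  by apply/ffunP=> j; rewrite ffunE ffun_consS.
move=> c _; apply/ffunP=> j; rewrite ffunE /=.
by case: unliftP => [i ->|->] //=; rewrite ffunE.
Qed.

End FfunSplit.

Section Alternants.

Variables (R : numDomainType) (l : nat).

Local Notation vec := {ffun 'I_l -> int}.

Definition vperm (s : 'S_l) (b : vec) : vec := [ffun i => b (s i)].

(** The vector lambda + rho. Integer entries keep subtraction exact, so that a negative entry can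
    signal a vanishing term. *)
Definition beta (lam : nat -> nat) : vec :=
  [ffun i : 'I_l => (lam i + (l - i.+1))%N%:Z].

Definition rho : vec := beta (fun=> 0%N).

(* The coefficient of [x^b] in the Vandermonde alternant. *)
Definition alternant (b : vec) : R :=
  \sum_(w : 'S_l) (-1) ^+ w *+ (b == vperm w rho).

Definition antisym (g : vec -> R) :=
  forall i j (b : vec), i != j -> g (vperm (tperm i j) b) = - g b.

Definition nneg_supp (g : vec -> R) := forall (b : vec) i, b i < 0 -> g b = 0.

Lemma vpermE s b i : vperm s b i = b (s i).
Proof. by rewrite ffunE. Qed.

Lemma vecBE (b c : vec) i : (b - c) i = b i - c i.
Proof. by rewrite !ffunE. Qed.

Lemma vecDE (b c : vec) i : (b + c) i = b i + c i.
Proof. by rewrite !ffunE. Qed.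

Lemma betaE lam i : beta lam i = (lam i + (l - i.+1))%N%:Z.
Proof. by rewrite ffunE. Qed.

Lemma vpermM s t b : vperm (s * t)%g b = vperm s (vperm t b).
Proof. by apply/ffunP=> i; rewrite !ffunE permM. Qed.

Lemma vperm1 b : vperm 1%g b = b.
Proof. by apply/ffunP=> i; rewrite !ffunE perm1. Qed.

Lemma vpermK s : cancel (vperm s) (vperm s^-1%g).
Proof. by move=> b; rewrite -vpermM mulVg vperm1. Qed.

Lemma vpermB s b c : vperm s (b - c) = vperm s b - vperm s c.
Proof. by apply/ffunP=> i; rewrite !ffunE. Qed.

Lemma rho_inj : injective rho.
Proof.
move=> i j; rewrite !ffunE => -[] e; apply: val_inj => /=.
by move: (ltn_ord i) (ltn_ord j) e; lia.
Qed.

Lemma vperm_rho_inj : injective (fun w => vperm w rho).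
Proof.
move=> u v e; apply/permP=> i; apply: rho_inj.
by move/ffunP/(_ i): e; rewrite [LHS]ffunE [RHS]ffunE.
Qed.

Lemma alternant_antisym : antisym alternant.
Proof.
move=> i j b ij; rewrite /alternant -sumrN.
rewrite (reindex_inj (mulgI (tperm i j))); apply: eq_bigr => w _ /=.
rewrite odd_permM odd_tperm ij /= signrN mulNrn; congr (- (_ *+ nat_of_bool _)).
by rewrite vpermM (can_eq (vpermK _)).
Qed.

Lemma alternant_nneg : nneg_supp alternant.
Proof.
move=> b i bi; rewrite /alternant big1 // => w _; case: eqP => // e.
by move: bi; rewrite e !ffunE.
Qed.

Lemma alternant_rho : alternant rho = 1.
Proof.
rewrite /alternant (bigD1 1%g) //= vperm1 eqxx odd_perm1 big1 ?addr0 // => w w1.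
case: eqP => // e; case/eqP: w1; apply: vperm_rho_inj.
by rewrite -e vperm1.
Qed.

Lemma alternant_le1 b : `|alternant b| <= 1.
Proof.
have [w bw|nb] := pickP (fun w => b == vperm w rho); last first.
  by rewrite /alternant big1 ?normr0 // => w _; rewrite nb.
rewrite /alternant (bigD1 w) //= bw big1 ?addr0 ?normr_sign // => u uw.
case: eqP => // e; case/eqP: uw; apply: vperm_rho_inj.
by rewrite -e -(eqP bw).
Qed.

Lemma antisym_eq0 g (b : vec) i j : antisym g -> i != j -> b i = b j -> g b = 0.
Proof.
move=> asg ij bij; suff: g b = - g b.
  by move/eqP; rewrite -addr_eq0 -mulr2n mulrn_eq0 => /eqP.
rewrite -(asg _ _ _ ij); congr g; apply/ffunP=> k; rewrite !ffunE.
by case: tpermP => [->|->|].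
Qed.

(* Over the index type [K], iterates the multiplication of the alternant by the
   generating functions [\sum_(k | P j k) x^(w j k)], coefficientwise. *)
Fixpoint conv (K : finType) m (P : nat -> pred K) (w : nat -> K -> vec)
    (b : vec) : R :=
  if m is m'.+1 then
    \sum_(k | P 0%N k) conv m' (fun j => P j.+1) (fun j => w j.+1) (b - w 0%N k)
  else alternant b.

(** Expansion of the product: [c] records the term chosen in each factor. *)
Lemma sum_ffun_conv (K : finType) m (P : nat -> pred K)
    (w : nat -> K -> vec) b :
  \sum_(c : {ffun 'I_m -> K} | [forall j : 'I_m, P j (c j)])
     alternant (b - \sum_(j < m) w j (c j)) = conv m P w b.
Proof.
elim: m => [|m IHm] in P w b *; rewrite /=.
  rewrite (big_pred1 (ffun0 (card_ord 0))); first by rewrite big_ord0 subr0.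
  move=> c /=; rewrite (_ : [forall _, _]); last by apply/forallP=> -[].
  by apply/esym/eqP/ffunP=> -[].
rewrite big_ffun_cons [RHS]big_mkcond /=; apply: eq_bigr => k _.
case: ifP => Pk; last first.
  rewrite big_pred0 // => c; apply/negbTE/forallPn; exists ord0.
  by rewrite ffun_cons0 Pk.
rewrite -IHm; apply: eq_big => c; last first.
  move=> _; rewrite big_ord_recl ffun_cons0 opprD addrA.
  by congr (alternant (_ - _)); apply: eq_bigr => j _; rewrite ffun_consS.
apply/idP/idP=> /forallP Pc; apply/forallP=> j.
  by have := Pc (lift ord0 j); rewrite ffun_consS.
by case: (unliftP ord0 j) => [i ->|->]; rewrite ?ffun_cons0 // ffun_consS;
  apply: Pc.
Qed.


End Alternants.

(** * The Pieri rule *)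

Definition vecE := (vecBE, vecDE, vpermE, betaE).

Section Equivariance.

Variables (R : numDomainType) (l : nat) (K : finType) (m : nat).
Local Notation vec := {ffun 'I_l -> int}.
Variables (P : nat -> pred K) (w : nat -> K -> vec).

(** The action [act] of S_l on the terms makes every factor a symmetric function, and a symmetric
    multiple of the alternant is antisymmetric. *)
Lemma conv_antisym (act : 'S_l -> K -> K) :
    (forall s, cancel (act s) (act s^-1%g)) ->
    (forall j s k, P j (act s k) = P j k) ->
    (forall j s k, w j (act s k) = vperm s (w j k)) ->
  antisym (@conv R l K m P w).
Proof.
elim: m P w => [|m' IHm] P' w' actK actP actw i j b ij /=.
  exact: alternant_antisym.
rewrite -sumrN; have acti : injective (act (tperm i j)) by apply: can_inj.
rewrite (reindex_inj acti); apply: eq_big => k; first by rewrite actP.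
by move=> _; rewrite actw -vpermB IHm // => ? ? ?; rewrite (actP, actw).
Qed.

Lemma conv_nneg : (forall j k i, 0 <= w j k i) -> nneg_supp (@conv R l K m P w).
Proof.
elim: m P w => [|m' IHm] P' w' w_ge0 b i bi /=; first exact: alternant_nneg bi.
rewrite big1 // => k _; apply: (IHm _ _ _ _ i) => //.
by rewrite vecBE subr_lt0 (lt_le_trans bi).
Qed.

End Equivariance.

Section Pieri.

Variables (R : numDomainType) (l n : nat).
Local Notation vec := {ffun 'I_l -> int}.
Local Notation bvec := {ffun 'I_l -> 'I_n.+1}.
Implicit Types (b v : vec) (c : bvec).

Definition vec_of c : vec := [ffun i => (c i)%:Z].
Lemma vec_ofE c i : vec_of c i = (c i)%:Z.
Proof. by rewrite ffunE. Qed.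

Definition bvec_of v : bvec := [ffun i => inord `|v i|%N].

Lemma vec_ofK : cancel vec_of bvec_of.
Proof.
by move=> c; apply/ffunP=> i; rewrite !ffunE; apply: val_inj; rewrite /= inordK.
Qed.

Lemma bvec_ofK v : (forall i, 0 <= v i) -> \sum_i v i <= n%:Z ->
  vec_of (bvec_of v) = v.
Proof.
move=> v_ge0 vn; apply/ffunP=> i; rewrite !ffunE inordK.
  by rewrite gez0_abs.
have : v i <= n%:Z.
  by apply: le_trans vn; rewrite (bigD1 i) //= lerDl sumr_ge0.
by have := v_ge0 i; lia.
Qed.

(* Exchanging the entries [i] and [j] of [b - c] is a sign-reversing
   involution on the terms of the sum. *)
Lemma pieri_cancel (g : vec -> R) b (k : int) i j (Q : pred vec) :
    antisym g -> i != j -> k <= n%:Z -> b j <= b i ->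
    (forall v, Q (vperm (tperm i j) v) = Q v) ->
  \sum_(c : bvec | [&& \sum_i vec_of c i == k, (b - vec_of c) i <= b j
                      & Q (b - vec_of c)]) g (b - vec_of c) = 0.
Proof.
move=> asg ij kn bji Qt; set t := tperm i j.
pose A (c : bvec) := [&& \sum_i vec_of c i == k, (b - vec_of c) i <= b j
                      & Q (b - vec_of c)].
pose sw (c : bvec) := bvec_of (b - vperm t (b - vec_of c)).
have tt v : vperm t (vperm t v) = v by rewrite -vpermM tperm2 vperm1.
have sum_t c : \sum_x (b - vperm t (b - vec_of c)) x = \sum_x vec_of c x.
  rewrite (eq_bigr (fun x => b x - (b - vec_of c) (t x))); last first.
    by move=> x _; rewrite !vecE.
  rewrite sumrB.
  have <- : \sum_x (b - vec_of c) x = \sum_x (b - vec_of c) (t x).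
    by rewrite [LHS](reindex_inj (@perm_inj _ t)).
  by rewrite -sumrB; apply: eq_bigr => x _; rewrite vecBE subKr.
(* The exchange turns [c i] into [b i - b j + c j] and [c j] into [b j - (b i - c i)]. Both are
   nonnegative because [b j <= b i] and [(b - vec_of c) i <= b j]; the total stays [k <= n], so the
   result is again a bounded vector. *)
have swE c : A c -> b - vec_of (sw c) = vperm t (b - vec_of c).
  case/and3P=> /eqP ck cij _; rewrite bvec_ofK ?subKr //; last first.
    by rewrite sum_t ck.
  move=> x; rewrite /t; move: cij; rewrite !(vecE, vec_ofE).
  by case: tpermP => [->|->|_ _]; lia.
have swA c : A c -> A (sw c).
  move=> Ac; have e := swE c Ac; case/and3P: Ac => /eqP ck cij Qc.
  apply/and3P; split; last by rewrite e Qt.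
    by rewrite -ck -(sum_t c) -e subKr.
  by rewrite e !(vecE, vec_ofE) tpermL; lia.
have swK c : A c -> sw (sw c) = c.
  by move=> Ac; rewrite {1}/sw swE // tt subKr vec_ofK.
rewrite -/A; set S := (X in X = 0); suff: S = - S.
  by move/eqP; rewrite -addr_eq0 -mulr2n mulrn_eq0 => /eqP.
rewrite {1}/S (reindex_onto sw sw) // -sumrN; apply: eq_big => c.
  apply/andP/idP=> [[Ac /eqP <-] | Ac]; first exact: swA.
  by split; [apply: swA | apply/eqP/swK].
case/andP=> /swA Ac /eqP e; rewrite e in Ac.
by rewrite swE // asg.
Qed.

Section Row.

Variables (g : vec -> R) (lam : nat -> nat) (k : int).
Hypotheses (asg : antisym g) (g_nneg : nneg_supp g) (l_gt0 : (0 < l)%N).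
Hypotheses (lam_noninc : forall i, (lam i.+1 <= lam i)%N) (lam_l : lam l = 0%N).
Hypothesis kn : k <= n%:Z.

(** The row bounds are imposed one at a time. A violation in row [m] means that entry [m] of the
    difference is at most entry [m.+1] of [beta l lam], and such terms cancel by [pieri_cancel]. *)
Lemma pieri_partial m : (m < l)%N ->
  \sum_(c : bvec | \sum_i vec_of c i == k) g (beta l lam - vec_of c) =
  \sum_(c : bvec | (\sum_i vec_of c i == k) &&
      [forall i : 'I_l, (i < m)%N ==> (c i <= lam i - lam i.+1)%N])
    g (beta l lam - vec_of c).
Proof.
elim: m => [|m IHm] ml.
  apply: eq_bigl => c; rewrite (_ : [forall _, _]) ?andbT //.
  by apply/forallP=> i; rewrite ltn0.
have ml' : (m < l)%N by apply: ltnW.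
rewrite IHm //.
rewrite (bigID (fun c : bvec => c (Ordinal ml') <= lam m - lam m.+1)%N) /=.
rewrite [X in _ + X](_ : _ = 0) ?addr0.
  apply: eq_bigl => c; rewrite -andbA; congr (_ && _).
  apply/andP/forallP=> [[/forallP cm cmm] i | cm].
    apply/implyP; rewrite ltnS leq_eqVlt => /orP[/eqP im|im].
      by have -> : i = Ordinal ml' by apply: val_inj.
    exact: (implyP (cm i)).
  split; last exact: (implyP (cm (Ordinal ml')) (ltnSn m)).
  by apply/forallP=> i; apply/implyP=> im; apply: (implyP (cm i)); apply: ltnW.
(* [Q] expresses the bounds on the rows before [m] through the difference. It involves neither entry
   [m] nor entry [m.+1], so the exchange preserves it. *)
pose Q (v : vec) := [forall i : 'I_l,
  (i < m)%N ==> ((lam i.+1 + (l - i.+2))%N%:Z < v i)].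
have := @pieri_cancel g (beta l lam) k (Ordinal ml') (Ordinal ml) Q.
move=> H; rewrite -[RHS]H //; last 2 first.
- by rewrite !betaE /=; have := lam_noninc m; lia.
- move=> v; apply: eq_forallb => i; case: (ltnP i m) => //= im.
  by rewrite vpermE tpermD // -val_eqE /=; lia.
- apply: eq_bigl => c; rewrite -andbA; congr (_ && _); rewrite andbC.
  congr (_ && _).
    by rewrite !(vecE, vec_ofE) /=; have := lam_noninc m; lia.
  apply: eq_forallb => i; case: (ltnP i m) => //= im.
  by rewrite !(vecE, vec_ofE) /=; have := lam_noninc i; lia.
- by rewrite -val_eqE /=; lia.
Qed.

(** Only the last row is left: as [lam l = 0], exceeding its bound makes an entry of the difference
    negative, where [g] vanishes. The surviving terms are the horizontal strips. *)
Lemma pieri_strip :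
  \sum_(c : bvec | \sum_i vec_of c i == k) g (beta l lam - vec_of c) =
  \sum_(c : bvec | (\sum_i vec_of c i == k) &&
      [forall i : 'I_l, (c i <= lam i - lam i.+1)%N])
    g (beta l lam - vec_of c).
Proof.
have ll : (l.-1 < l)%N by lia.
rewrite (pieri_partial ll) [LHS]big_mkcond [RHS]big_mkcond.
apply: eq_bigr => c _; case: eqP => //= ck.
case: ifP; case: ifP => // /forallP c1 /forallP c2.
  have: ~~ (c (Ordinal ll) <= lam l.-1)%N.
    apply/negP=> cl; apply: c1 => i.
    case: (ltnP i l.-1) => il; first exact: (implyP (c2 i)).
    have -> : i = Ordinal ll by apply: val_inj => /=; have := ltn_ord i; lia.
    by rewrite /= (ltn_predK ll) lam_l subn0.
  rewrite -ltnNge => cl; apply: (g_nneg (i := Ordinal ll)).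
  by rewrite !(vecE, vec_ofE) /= (ltn_predK ll) subnn addn0 subr_lt0.
by case: c2 => i; apply/implyP=> _; apply: c1.
Qed.

Lemma sum_row_gaps q : (\sum_(i < q) (lam i - lam i.+1) + lam q = lam 0)%N.
Proof.
elim: q => [|q IHq]; first by rewrite big_ord0.
by rewrite big_ord_recr /= -addnA subnK.
Qed.

Lemma vec_of_sum c : \sum_i vec_of c i = (\sum_i c i)%N%:Z.
Proof.
rewrite (big_morph Posz PoszD (erefl _)).
by apply: eq_bigr => i _; rewrite vec_ofE.
Qed.

(** The row gaps telescope, so a horizontal strip has at most [lam 0] cells. *)
Lemma pieri_row_gt : (lam 0)%:Z < k ->
  \sum_(c : bvec | \sum_i vec_of c i == k) g (beta l lam - vec_of c) = 0.
Proof.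
move=> lk; rewrite pieri_strip big1 // => c /andP[/eqP ck /forallP cl].
have : (\sum_i c i <= lam 0)%N.
  by rewrite -(sum_row_gaps l) lam_l addn0; apply: leq_sum.
by rewrite leqNgt -ltz_nat -vec_of_sum ck lk.
Qed.

(** The only horizontal strip with [lam 0] cells takes every gap in full; removing it amounts to
    deleting the first row. *)
Lemma pieri_row_eq : (lam 0)%:Z = k ->
  \sum_(c : bvec | \sum_i vec_of c i == k) g (beta l lam - vec_of c) =
  g (beta l (fun i => lam i.+1)).
Proof.
move=> lk; rewrite pieri_strip.
pose c0 : bvec := [ffun i : 'I_l => inord (lam i - lam i.+1)%N].
have c0E i : c0 i = (lam i - lam i.+1)%N :> nat.
  rewrite ffunE inordK //; have := sum_row_gaps i.+1; rewrite big_ord_recr /=.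
  by move: kn lk; lia.
rewrite (big_pred1 c0).
  congr g; apply/ffunP=> i; rewrite !(vecE, vec_ofE) c0E.
  by have := lam_noninc i; lia.
move=> c; apply/andP/eqP=> [[/eqP ck /forallP cl]|->]; last first.
  split; last by apply/forallP=> i; rewrite c0E.
  rewrite vec_of_sum (eq_bigr _ (fun i _ => c0E i)) -lk.
  by have := sum_row_gaps l; rewrite lam_l addn0 => ->.
apply/ffunP=> i; apply: val_inj; rewrite /= c0E; apply/eqP.
have := leqif_sum (fun i (_ : true) => leqif_eq (cl i)).
case=> _; rewrite (_ : (_ == _) = true); last first.
  apply/eqP; have := sum_row_gaps l; rewrite lam_l addn0 => ->.
  by apply/eqP; rewrite -eqz_nat -vec_of_sum ck lk.
by move/esym/forallP/(_ i).
Qed.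

End Row.

End Pieri.

(** * Kostka numbers and rim hooks *)

Section Kostka.

Variables (R : numDomainType) (l n : nat).
Hypothesis l_gt0 : (0 < l)%N.
Local Notation vec := {ffun 'I_l -> int}.
Local Notation bvec := {ffun 'I_l -> 'I_n.+1}.

(** Coefficients of the alternant times the complete symmetric functions h_(nu 0), ..., h_(nu (m -
    1)), as long as each [nu j] is at most [n]; at [beta l lam] they are Kostka numbers. *)
Definition hconv m (nu : nat -> int) : vec -> R :=
  conv R m (fun j (c : bvec) => \sum_i vec_of c i == nu j)
    (fun _ c => vec_of c).

Lemma hconv_antisym m nu : antisym (hconv m nu).
Proof.
apply: (@conv_antisym _ _ _ _ _ _ (fun s (c : bvec) => [ffun i => c (s i)])).
- by move=> s c; apply/ffunP=> i; rewrite !ffunE permKV.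
- move=> j s c; congr (_ == _); rewrite [RHS](reindex_inj (@perm_inj _ s)).
  by apply: eq_bigr => i _; rewrite !ffunE.
- by move=> j s c; apply/ffunP=> i; rewrite !ffunE.
Qed.

Lemma hconv_nneg m nu : nneg_supp (hconv m nu).
Proof. by apply: conv_nneg => j c i; rewrite vec_ofE. Qed.

Lemma noninc_eq0 (lam : nat -> nat) :
  (forall i, (lam i.+1 <= lam i)%N) -> lam l = 0%N -> lam l.+1 = 0%N.
Proof. by move=> lam_ni lam_l; apply/eqP; rewrite -leqn0 -lam_l. Qed.

(** The first [i] factors delete the first [i] rows by [pieri_row_eq]; the next factor needs a strip
    longer than the new first row. *)
Lemma hconv_gt m nu (lam : nat -> nat) i :
    (forall i, (lam i.+1 <= lam i)%N) -> lam l = 0%N -> (i < m)%N ->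
    (forall j, (j < m)%N -> nu j <= n%:Z) ->
    (forall j, (j < i)%N -> nu j = (lam j)%:Z) -> (lam i)%:Z < nu i ->
  hconv m nu (beta l lam) = 0.
Proof.
elim: i m nu lam => [|i IHi] [|m] nu lam //= lam_ni lam_l im nu_n nu_eq nu_gt.
  apply: (pieri_row_gt (@hconv_antisym m (fun j => nu j.+1)) ) => //.
  - exact: hconv_nneg.
  - exact: nu_n.
have := pieri_row_eq (@hconv_antisym m (fun j => nu j.+1)).
rewrite /hconv /= => ->; rewrite -/(hconv _ _); last 1 first.
- by rewrite nu_eq.
- apply: IHi => // [|j jm|j ji]; [exact: noninc_eq0|exact: nu_n|exact: nu_eq].
- exact: hconv_nneg.
- by [].
- by [].
- by [].
- exact: nu_n.
Qed.

(** Each factor deletes one row by [pieri_row_eq], until the empty shape leaves [rho], where the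
    alternant is 1. *)
Lemma hconv_eq m nu (lam : nat -> nat) :
    (forall i, (lam i.+1 <= lam i)%N) -> lam l = 0%N -> lam m = 0%N ->
    (forall j, (j < m)%N -> nu j <= n%:Z) ->
    (forall j, (j < m)%N -> nu j = (lam j)%:Z) ->
  hconv m nu (beta l lam) = 1.
Proof.
elim: m nu lam => [|m IHm] nu lam lam_ni lam_l lam_m nu_n nu_eq.
  rewrite /hconv /= -[RHS](alternant_rho R l); congr alternant.
  apply/ffunP=> i; rewrite !betaE; suff -> : lam i = 0%N by [].
  elim: (i : nat) => // k IHk; apply/eqP.
  by rewrite -leqn0; apply: leq_trans (lam_ni k) _; rewrite IHk.
have := pieri_row_eq (@hconv_antisym m (fun j => nu j.+1)).
rewrite /hconv /= => ->; rewrite -/(hconv _ _); last 1 first.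
- by rewrite nu_eq.
- apply: IHm => // [|j jm|j ji]; [exact: noninc_eq0|exact: nu_n|exact: nu_eq].
- exact: hconv_nneg.
- by [].
- by [].
- by [].
- exact: nu_n.
Qed.

End Kostka.

(** * Products of the alternant with power sums *)

Section RimHooks.

Variables (R : numDomainType) (l : nat).
Local Notation vec := {ffun 'I_l -> int}.

Definition unit_vec (k : nat) (i : 'I_l) : vec :=
  [ffun j => (k * (i == j))%N%:Z].

(** Coefficients of the alternant times the power sums of degrees [ks 0], ..., [ks (m - 1)].
    Subtracting from one entry of lambda + rho corresponds to removing a rim hook, as in the
    Murnaghan-Nakayama rule. *)
Definition pconv m (ks : nat -> nat) : vec -> R :=
  conv R m (fun _ => predT) (fun j i => unit_vec (ks j) i).

Lemma pconv_antisym m ks : antisym (pconv m ks).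
Proof.
apply: (@conv_antisym _ _ _ _ _ _ (fun s (i : 'I_l) => (s^-1)%g i)) => //.
  by move=> s i; rewrite /= invgK permKV.
move=> j s i; apply/ffunP=> x; rewrite !ffunE.
by rewrite -(inj_eq (@perm_inj _ s)) permKV.
Qed.

Lemma pconv_nneg m ks : nneg_supp (pconv m ks).
Proof. by apply: conv_nneg => j c i; rewrite ffunE. Qed.

(* Moving the entry [b i] down to [b i - k] keeps [b] injective only if [b i] is
   one of the at most [d] entries [>= l], or if [b i - k] is one of the
   at most [d] elements of [0, l) that are not entries. *)
Lemma card_moves (b : vec) k d : (0 < k)%N -> injective b ->
    (forall i, 0 <= b i) -> (#|[set i | (l%:Z <= b i)%R]| <= d)%N ->
  (#|[set i | ([forall j, 0 <= (b - unit_vec k i) j] &&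
              injectiveb (b - unit_vec k i))%R]| <= 2 * d)%N.
Proof.
move=> k_gt0 b_inj b_ge0 Ad; set A := [set i | _] in Ad; set G := [set i | _].
have bGE i : (b - unit_vec k i) i = b i - k%:Z.
  by rewrite vecBE ffunE eqxx muln1.
have bGN i j : i != j -> (b - unit_vec k i) j = b j.
  by move=> /negbTE ij; rewrite vecBE ffunE ij muln0 subr0.
pose f (i : 'I_l) : 'I_l := insubd i `|b i|%N.
pose g (i : 'I_l) : 'I_l := insubd i `|b i - k%:Z|%N.
have fE i : i \in ~: A -> (f i)%:Z = b i.
  rewrite !inE -ltNge => bi; have := b_ge0 i => bi0.
  by rewrite val_insubd ifT; move: bi bi0; lia.
have gE i : i \in G :\: A -> (g i)%:Z = b i - k%:Z.
  rewrite !inE -ltNge => /andP[bi /andP[/forallP/(_ i)]]; rewrite bGE => bi0 _.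
  by rewrite val_insubd ifT; move: bi bi0; lia.
have f_inj : {in ~: A &, injective f}.
  by move=> i j Ai Aj fij; apply: b_inj; rewrite -fE // -(fE j) // fij.
have g_inj : {in G :\: A &, injective g}.
  move=> i j Gi Gj gij; apply: b_inj; apply: (addIr (- k%:Z)).
  by rewrite -gE // -(gE j) // gij.
(* If [b j - k] were already an entry [b i], moving entry [j] would create a repetition. *)
have fg0 : [disjoint f @: ~: A & g @: (G :\: A)].
  apply/pred0P=> x /=; apply/negP=> /andP[/imsetP[i Ai ->] /imsetP[j Gj fg]].
  have bij : b i = b j - k%:Z by rewrite -fE // -gE // fg.
  have ij : j != i by apply/eqP=> e; move: bij k_gt0; rewrite e; lia.
  move: Gj; rewrite !inE => /andP[_ /andP[_ /injectiveP inj]].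
  by case/eqP: (ij); apply: inj; rewrite bGE bGN.
(* Two disjoint images inside [0, l) give [#|G :\: A| <= l - #|~: A| = #|A|]. *)
have : (#|G :\: A| + #|~: A| <= l)%N.
  rewrite -(card_in_imset f_inj) -(card_in_imset g_inj) addnC.
  have := leq_card_setU (f @: ~: A) (g @: (G :\: A)); rewrite fg0 => -[_].
  by move/eqP <-; rewrite -[leqRHS]card_ord max_card.
have := cardsC A; have := cardsID A G; rewrite card_ord.
have := subset_leq_card (subsetIr G A); lia.
Qed.

Lemma pconv_bound m ks (b : vec) d : (forall j, 0 < ks j)%N ->
    (#|[set i | (l%:Z <= b i)%R]| <= d)%N ->
  `|pconv m ks b| <= (2 * d)%N%:R ^+ m.
Proof.
elim: m ks b => [|m IHm] ks b ks_gt0 bd; first by rewrite expr0 alternant_le1.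
have [/injectiveP b_inj|] := boolP (injectiveb b); last first.
  case/injectivePn=> i [j ij bij].
  by rewrite (antisym_eq0 (@pconv_antisym _ _) ij bij) normr0 exprn_ge0.
have [/forallP b_ge0|/forallPn[i]] := boolP [forall i, 0 <= b i]; last first.
  by rewrite -ltNge => /pconv_nneg ->; rewrite normr0 exprn_ge0.
apply: le_trans (ler_norm_sum _ _ _) _.
set G := [set i | [forall j, (b - unit_vec (ks 0%N) i) j >= 0] &&
              injectiveb (b - unit_vec (ks 0%N) i)].
rewrite (bigID (mem G)) /= [X in _ + X]big1 ?addr0 => [|i]; last first.
  rewrite inE negb_and => /orP[/forallPn[j]|/injectivePn[j [j' jj' e]]].
    rewrite -ltNge => bj; apply/eqP; rewrite normr_eq0; apply/eqP.
    exact: (@pconv_nneg m (fun j => ks j.+1) _ j).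
  apply/eqP; rewrite normr_eq0; apply/eqP.
  exact: (antisym_eq0 (@pconv_antisym m (fun j => ks j.+1)) jj' e).
apply: (@le_trans _ _ (\sum_(i in G) (2 * d)%N%:R ^+ m)).
  apply: ler_sum => i _; apply: IHm => //.
  (* Lowering an entry creates no new entry [>= l], so the same [d] serves the remaining factors. *)
  apply: leq_trans bd; apply: subset_leq_card; apply/subsetP=> j.
  by rewrite !inE vecBE ffunE; lia.
rewrite sumr_const exprS -[X in X <= _]mulr_natl.
rewrite ler_wpM2r ?exprn_ge0 // ler_nat.
exact: card_moves.
Qed.

End RimHooks.

(** * Fibres of functions and Burnside's lemma *)

Section Burnside.

Variables (n : nat) (T : finType).
Local Notation fn := {ffun 'I_n -> T}.
Implicit Types (h : fn) (s : 'S_n).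

Definition precomp s h : fn := [ffun k => h (s k)].

Definition fiber_card h : {ffun T -> 'I_n.+1} :=
  [ffun t => inord #|[set k | h k == t]|].

Lemma precompM s1 s2 h : precomp (s1 * s2) h = precomp s1 (precomp s2 h).
Proof. by apply/ffunP=> k; rewrite !ffunE permM. Qed.

Lemma precomp1 h : precomp 1 h = h.
Proof. by apply/ffunP=> k; rewrite ffunE perm1. Qed.

Lemma precompK s : cancel (precomp s) (precomp s^-1).
Proof. by move=> h; rewrite -precompM mulVg precomp1. Qed.

Lemma precompKV s : cancel (precomp s^-1) (precomp s).
Proof. by move=> h; rewrite -precompM mulgV precomp1. Qed.

Lemma fiber_cardE h t : fiber_card h t = #|[set k | h k == t]| :> nat.
Proof. by rewrite ffunE inordK // ltnS -[leqRHS]card_ord max_card. Qed.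

Lemma fiber_card_precomp s h : fiber_card (precomp s h) = fiber_card h.
Proof.
apply/ffunP=> t; apply: val_inj; rewrite /= !fiber_cardE.
rewrite -(card_imset _ (@perm_inj _ s)); apply: eq_card => k; rewrite inE.
apply/imsetP/idP=> [[i + ->]|hk]; first by rewrite inE ffunE.
by exists (s^-1%g k); rewrite ?inE ?ffunE permKV.
Qed.

Lemma fiber_card_count h t :
  fiber_card h t = count_mem t [tuple h k | k < n] :> nat.
Proof.
by rewrite fiber_cardE /= count_map -sum1_count big_enum_cond sum1dep_card.
Qed.

(** Fibre sizes are the multiplicities in the list of values, and lists with equal multiplicities
    are rearrangements of each other. *)
Lemma fiber_card_trans h1 h2 :
  fiber_card h1 = fiber_card h2 -> exists s, h1 = precomp s h2.
Proof.
move=> e; have : perm_eq [tuple h1 k | k < n] [tuple h2 k | k < n].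
  by apply/allP=> t _ /=; rewrite -!fiber_card_count e.
case/tuple_permP=> s /val_inj es; exists s; apply/ffunP=> k.
by rewrite ffunE -[LHS](tnth_mktuple h1) es !tnth_mktuple.
Qed.

Lemma sum_fiber_card h : (\sum_t fiber_card h t)%N = n.
Proof.
rewrite (eq_bigr _ (fun t _ => fiber_cardE h t)) -[RHS]card_ord -sum1_card.
rewrite (partition_big h predT) //=; apply: eq_bigr => t _.
by rewrite sum1dep_card.
Qed.

Lemma fiber_card_onto (c : {ffun T -> 'I_n.+1}) :
  (\sum_t c t)%N = n -> exists h, fiber_card h = c.
Proof.
move=> cn; pose s := flatten [seq nseq (c t) t | t <- enum T].
have sz : size s == n.
  rewrite size_flatten /shape -map_comp sumnE big_map big_enum /=.
  rewrite -[X in _ == X]cn.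
  by apply/eqP/eq_bigr => t _; rewrite size_nseq.
exists [ffun k => tnth (Tuple sz) k]; apply/ffunP=> t; apply: val_inj.
rewrite /= fiber_card_count.
have -> : [tuple [ffun k => tnth (Tuple sz) k] k | k < n] = Tuple sz.
  by apply: eq_from_tnth => k; rewrite tnth_mktuple ffunE.
rewrite /= count_flatten -map_comp sumnE big_map big_enum (bigD1 t) //=.
rewrite count_nseq /= eqxx mul1n big1 ?addn0 // => t' tt'.
by rewrite count_nseq /= (negbTE tt') mul0n.
Qed.

(** The functions with fibre sizes [c] form one orbit. Sorting S_n by the image of a base point [h0]
    gives classes that are cosets of the stabilisers. *)
Lemma sum_stab_fiber (c : {ffun T -> 'I_n.+1}) : (\sum_t c t)%N = n ->
  (\sum_(h | fiber_card h == c) #|[set s | precomp s h == h]|)%N = n`!.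
Proof.
case/fiber_card_onto=> h0 h0c; rewrite -card_Sn -sum1_card.
rewrite (partition_big (fun s => precomp s h0) (fun h => fiber_card h == c)).
  apply: eq_bigr => h /eqP hc.
  have [s hs] := fiber_card_trans (etrans hc (esym h0c)).
  rewrite sum1dep_card -(card_imset _ (mulIg s)); apply: eq_card => u.
  rewrite [RHS]inE; apply/imsetP/idP=> [[v + ->]|/eqP uh].
    by rewrite inE precompM -hs.
  by exists (u * s^-1)%g; rewrite ?mulgKV // inE precompM hs precompK uh hs.
by move=> s _; rewrite fiber_card_precomp h0c.
Qed.

Lemma burnside_fiber (V : nmodType) (F : {ffun T -> 'I_n.+1} -> V) :
  \sum_(s : 'S_n) \sum_(h | precomp s h == h) F (fiber_card h) =
  (\sum_(c : {ffun T -> 'I_n.+1} | (\sum_t c t)%N == n) F c) *+ n`!.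
Proof.
rewrite (exchange_big_dep predT) //= -sumrMnl.
rewrite (partition_big fiber_card (fun c => (\sum_t c t)%N == n)) /=;
  last first.
  by move=> h _; rewrite sum_fiber_card.
apply: eq_bigr => c /eqP cn; rewrite -(sum_stab_fiber cn) -sumrMnr.
apply: eq_bigr => h /eqP ->; rewrite sumr_const; congr (_ *+ _).
by apply: eq_card => s; rewrite !inE.
Qed.

End Burnside.

(** * Inner products with permutation characters *)

Section InnerProduct.

Variables (R : numDomainType) (l n : nat).
Local Notation vec := {ffun 'I_l -> int}.
Local Notation bvec := {ffun 'I_l -> 'I_n.+1}.
Local Notation fn := {ffun 'I_n -> 'I_l}.

Definition weight (f : fn) : vec := vec_of (fiber_card f).

Definition nfixed (nu : vec) (s : 'S_n) : nat :=
  #|[set f : fn | (precomp s f == f) && (weight f == nu)]|.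

(** Frobenius' formula with the signed sum over w absorbed into the alternant; [frobeniusE] recovers
    that sum. *)
Definition frobenius (b : vec) (s : 'S_n) : R :=
  \sum_(f : fn | precomp s f == f) alternant R (b - weight f).

Lemma frobeniusE b s :
  frobenius b s =
  \sum_(w : 'S_l) (-1) ^+ w * (nfixed (b - vperm w (rho l)) s)%:R.
Proof.
rewrite /frobenius /alternant exchange_big /=; apply: eq_bigr => w _.
rewrite /nfixed -sum1dep_card natr_sum mulr_sumr [RHS]big_mkcondr /=.
apply: eq_bigr => f _; rewrite -(inj_eq (subrI b)) subKr.
by case: eqP; rewrite ?mulr1.
Qed.

(** Two functions fixed by [s] are one fixed function into pairs, whose fibre sizes form a matrix
    with the two weights as row and column sums. [burnside_fiber] leaves a sum over matrices, whose
    column [j] is the exponent of a monomial of h_(nu j). *)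
Lemma sum_frobenius_nfixed (nu : nat -> int) b :
    \sum_(i < l) nu i = n%:Z ->
  \sum_(s : 'S_n) frobenius b s *+ nfixed [ffun i : 'I_l => nu i] s =
  hconv R n l nu b *+ n`!.
Proof.
move=> nu_n; set nu' := [ffun i => _].
pose T := ('I_l * 'I_l)%type.
pose row (c : {ffun T -> 'I_n.+1}) : vec := [ffun i => \sum_j (c (i, j))%:Z].
pose col (c : {ffun T -> 'I_n.+1}) : vec := [ffun j => \sum_i (c (i, j))%:Z].
pose F c := alternant R (b - row c) *+ (col c == nu').
pose fst_fn (h : {ffun 'I_n -> T}) : fn := [ffun k => (h k).1].
pose snd_fn (h : {ffun 'I_n -> T}) : fn := [ffun k => (h k).2].
have pairE h i j : fiber_card h (i, j) =
    #|[set k | (fst_fn h k == i) && (snd_fn h k == j)]| :> nat.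
  rewrite fiber_cardE; apply: eq_card => k; rewrite !inE !ffunE.
  by rewrite [h k]surjective_pairing xpair_eqE.
have rowE h : row (fiber_card h) = weight (fst_fn h).
  apply/ffunP=> i; rewrite ffunE vec_ofE fiber_cardE -sum1dep_card.
  rewrite (partition_big (snd_fn h) predT) //= (big_morph Posz PoszD (erefl _)).
  by apply: eq_bigr => j _; rewrite sum1dep_card pairE.
have colE h : col (fiber_card h) = weight (snd_fn h).
  apply/ffunP=> j; rewrite ffunE vec_ofE fiber_cardE -sum1dep_card.
  rewrite (partition_big (fst_fn h) predT) //= (big_morph Posz PoszD (erefl _)).
  apply: eq_bigr => i _; rewrite sum1dep_card pairE; congr (_%:Z).
  by apply: eq_card => k; rewrite !inE andbC.
pose pair_fn (p : fn * fn) : {ffun 'I_n -> T} := [ffun k => (p.1 k, p.2 k)].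
have pair_bij : bijective pair_fn.
  exists (fun h => (fst_fn h, snd_fn h)) => [[f g]|h] /=.
    by congr (_, _); apply/ffunP=> k; rewrite !ffunE.
  by apply/ffunP=> k; rewrite !ffunE -surjective_pairing.
transitivity (\sum_(s : 'S_n) \sum_(h | precomp s h == h) F (fiber_card h)).
  apply: eq_bigr => s _; rewrite (reindex pair_fn) /=; last exact: onW_bij.
  rewrite /frobenius /nfixed.
  transitivity (\sum_(f | precomp s f == f) \sum_(g | precomp s g == g)
                  F (fiber_card (pair_fn (f, g)))); last first.
    rewrite pair_big_dep; apply: eq_big => [[f g]|[f g] _] //=.
    apply/andP/eqP=> [[/eqP/ffunP e1 /eqP/ffunP e2]|/ffunP e].
      by apply/ffunP=> k; move: (e1 k) (e2 k); rewrite !ffunE => /= -> ->.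
    by split; apply/eqP/ffunP=> k; move: (e k); rewrite !ffunE => -[].
  rewrite -sumrMnl; apply: eq_bigr => f _.
  rewrite -sum1dep_card -sumrMnr big_mkcondr /=; apply: eq_bigr => g _.
  rewrite /F rowE colE.
  have -> : fst_fn (pair_fn (f, g)) = f by apply/ffunP=> k; rewrite !ffunE.
  have -> : snd_fn (pair_fn (f, g)) = g by apply/ffunP=> k; rewrite !ffunE.
  by case: eqP.
rewrite burnside_fiber; congr (_ *+ _).
rewrite /hconv -sum_ffun_conv.
pose curry (c : {ffun T -> 'I_n.+1}) : {ffun 'I_l -> bvec} :=
  [ffun j => [ffun i => c (i, j)]].
rewrite [RHS](reindex curry); last first.
  exists (fun d : {ffun 'I_l -> bvec} => [ffun p : T => d p.2 p.1]).
    by move=> c _; apply/ffunP=> -[i j]; rewrite !ffunE.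
  by move=> d _; apply/ffunP=> j; apply/ffunP=> i; rewrite !ffunE.
rewrite /F big_mkcond [RHS]big_mkcond /=; apply: eq_bigr => c _.
have -> : [forall j, \sum_i vec_of (curry c j) i == nu j] = (col c == nu').
  apply/forallP/eqP=> [e|/ffunP e j].
    apply/ffunP=> j; rewrite [RHS]ffunE -(eqP (e j)) ffunE.
    by apply: eq_bigr => i _; rewrite !ffunE.
  have := e j; rewrite [nu' j]ffunE [col c j]ffunE => <-; apply/eqP.
  by apply: eq_bigr => i _; rewrite !ffunE.
have -> : b - \sum_(j < l) vec_of (curry c j) = b - row c.
  congr (_ - _); apply/ffunP=> i; rewrite sum_ffunE ffunE.
  by apply: eq_bigr => j _; rewrite !ffunE.
case: (col c =P nu') => [e|_]; last by case: ifP.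
(* The matrix has total [n] because its column sums are [nu]. *)
rewrite ifT //; apply/eqP/eqP; rewrite -eqz_nat -nu_n.
rewrite (big_morph Posz PoszD (erefl _)) (eq_bigr (fun p => (c (p.1, p.2))%:Z)).
  rewrite -(pair_bigA _ (fun i j => (c (i, j))%:Z)) exchange_big /=.
  apply/eqP/eq_bigr => j _; move/ffunP/(_ j): e.
  by rewrite ffunE [nu' j]ffunE.
by case.
Qed.

End InnerProduct.

(** * Permutation modules and virtual characters *)

Section WeightModules.

Variables (l n : nat).
Local Notation vec := {ffun 'I_l -> int}.
Local Notation fn := {ffun 'I_n -> 'I_l}.
Local Notation G := [set: 'S_n]%G.

Definition weight_set (nu : vec) : {set fn} := [set f | weight f == nu].

Lemma weight_precomp s (f : fn) : weight (precomp s f) = weight f.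
Proof. by rewrite /weight fiber_card_precomp. Qed.

Definition weight_mx nu (s : 'S_n) : 'M[algC]_#|weight_set nu| :=
  \matrix_(i, j) (enum_val i == precomp s (enum_val j))%:R.

Lemma weight_mx_repr nu : mx_repr G (weight_mx nu).
Proof.
split=> [|s t _ _]; apply/matrixP=> i k; rewrite !mxE.
  by rewrite precomp1 (inj_eq enum_val_inj).
have tk : precomp t (enum_val k) \in weight_set nu.
  by have := enum_valP k; rewrite !inE weight_precomp.
rewrite (bigD1 (enum_rank_in tk (precomp t (enum_val k)))) //= !mxE.
rewrite enum_rankK_in // eqxx mulr1 precompM big1 ?addr0 // => j jk.
rewrite !mxE; case: (_ =P precomp t _) => [e|_]; last by rewrite mulr0.
by case/eqP: jk; apply: enum_val_inj; rewrite enum_rankK_in.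
Qed.

Definition weight_repr nu := MxRepresentation (weight_mx_repr nu).

Lemma weight_charE nu s : cfRepr (weight_repr nu) s = (nfixed nu s)%:R.
Proof.
rewrite cfunE in_setT mulr1n /mxtrace /nfixed -[in RHS]sum1dep_card natr_sum.
rewrite (eq_bigr (fun i => (fun f => (f == precomp s f)%:R) (enum_val i))).
  rewrite -(big_enum_val (fun f : fn => (f == precomp s f)%:R)) /=.
  rewrite [RHS]big_mkcond [LHS]big_mkcond.
  apply: eq_bigr => f _; rewrite inE [f == _]eq_sym.
  by case: (weight f == nu); case: (precomp s f == f).
by move=> i _; rewrite mxE.
Qed.

Definition frob_cf (b : vec) : 'CF(G) :=
  \sum_(w : 'S_l) (-1) ^+ w *: cfRepr (weight_repr (b - vperm w (rho l))).

Lemma frob_cfE b s : frob_cf b s = frobenius algC b s.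
Proof.
rewrite frobeniusE sum_cfunE; apply: eq_bigr => w _.
by rewrite cfunE weight_charE.
Qed.

Lemma frob_cf_vchar b : frob_cf b \in 'Z[irr G]%g.
Proof.
apply: rpred_sum => w _; rewrite rpredZsign char_vchar //; exact: cfRepr_char.
Qed.

Lemma cfdot_frob_weight (nu : nat -> int) b : \sum_(i < l) nu i = n%:Z ->
  '[frob_cf b, cfRepr (weight_repr [ffun i : 'I_l => nu i])] =
  hconv algC n l nu b.
Proof.
move=> nu_n; rewrite cfdotE (_ : #|G| = n`!); last first.
  by rewrite -card_Sn; apply: eq_card => s; rewrite !inE.
have n0 : n`!%:R != 0 :> algC by rewrite pnatr_eq0 -lt0n fact_gt0.
apply: (mulfI n0); rewrite mulVKf // mulr_natl -sum_frobenius_nfixed //.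
apply: eq_big => [s|s _]; first by rewrite inE.
by rewrite frob_cfE weight_charE conjC_nat mulr_natr.
Qed.

Lemma weight_char_neg (nu : vec) i : nu i < 0 -> cfRepr (weight_repr nu) = 0.
Proof.
move=> nui; apply/cfunP=> s; rewrite weight_charE cfunE /nfixed.
rewrite (_ : [set f | _] = set0) ?cards0 //; apply/setP=> f; rewrite !inE.
apply/negbTE/nandP; right; apply: contraTneq nui => <-.
by rewrite vec_ofE.
Qed.

End WeightModules.

(** At the least moved index [i], all smaller values are already taken by the fixed points below
    [i]. *)
Lemma perm_neq1_rise l (w : 'S_l) : w != 1%g ->
  exists i : 'I_l, (forall j : 'I_l, (j < i)%N -> w j = j) /\ (i < w i)%N.
Proof.
move=> w1; have [i wi] : exists i, w i != i.
  apply/existsP; apply: contraNT w1 => /existsPn wi; apply/eqP/permP=> i.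
  by rewrite perm1; apply/eqP; have := wi i; rewrite negbK.
case: (@arg_minnP _ i (fun j => w j != j) (@nat_of_ord l) wi) => {wi}i wi imin.
have wj (j : 'I_l) : (j < i)%N -> w j = j.
  by move=> ji; apply/eqP; apply: contraLR ji => /imin; rewrite -leqNgt.
exists i; split=> //; rewrite ltn_neqAle eq_sym wi /= leqNgt.
by apply: contraNN wi => /wj /perm_inj ->.
Qed.

(** * The norm of the virtual character *)

Section Norm.

Variables (l n : nat) (lam : nat -> nat).
Local Notation vec := {ffun 'I_l -> int}.
Local Notation G := [set: 'S_n]%G.

Definition lex_gt (nu : vec) := exists i : 'I_l,
  (forall j : 'I_l, (j < i)%N -> nu j = (lam j)%:Z) /\ (lam i)%:Z < nu i.

(** Entry [i] of lambda + rho - w rho is [lam i + (w i - i)]; the first moved index exceeds [lam i]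
    by [perm_neq1_rise]. *)
Lemma lex_gt_perm w : w != 1%g -> lex_gt (beta l lam - vperm w (rho l)).
Proof.
case/perm_neq1_rise=> i [wj wi]; exists i; split=> [j ji|].
  by rewrite !vecE wj //; lia.
by rewrite !vecE; have := ltn_ord (w i); lia.
Qed.

Lemma beta_sub_rho :
  beta l lam - vperm 1 (rho l) = [ffun i : 'I_l => (lam i)%:Z].
Proof. by apply/ffunP=> i; rewrite !vecE perm1 ffunE; lia. Qed.

Hypotheses (l_gt0 : (0 < l)%N) (lam_l : lam l = 0%N).
Hypothesis lam_noninc : forall i, (lam i.+1 <= lam i)%N.
Hypothesis lam_n : (\sum_(i < l) lam i)%N = n.

Lemma cfdot_frob_shape :
  '[frob_cf n (beta l lam),
    cfRepr (weight_repr n [ffun i : 'I_l => (lam i)%:Z])] = 1.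
Proof.
have lam_nZ : \sum_(i < l) (lam i)%:Z = n%:Z.
  by rewrite -lam_n (big_morph Posz PoszD (erefl _)).
rewrite (@cfdot_frob_weight l n (fun j => (lam j)%:Z) _ lam_nZ).
rewrite hconv_eq // => j jl.
by rewrite lez_nat -lam_n (bigD1 (Ordinal jl)) //= leq_addr.
Qed.

Lemma cfdot_frob_lex (nu : vec) : \sum_i nu i = n%:Z -> lex_gt nu ->
  '[frob_cf n (beta l lam), cfRepr (weight_repr n nu)] = 0.
Proof.
move=> nu_n [i [nuj nui]].
have [/forallP nu_ge0|/forallPn[j]] := boolP [forall j, 0 <= nu j]; last first.
  by rewrite -ltNge => /weight_char_neg ->; rewrite cfdot0r.
(* [cfdot_frob_weight] takes a function on all naturals, so [nu] is extended by 0 beyond [l]. *)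
pose mu j : int := oapp nu 0 (insub j).
have muE (j : 'I_l) : mu j = nu j by rewrite /mu valK.
have -> : nu = [ffun j : 'I_l => mu j] by apply/ffunP=> j; rewrite ffunE muE.
have mu_n : \sum_(j < l) mu j = n%:Z.
  by rewrite -nu_n; apply: eq_bigr => j _; rewrite muE.
rewrite (cfdot_frob_weight _ mu_n) (hconv_gt _ _ _ _ (ltn_ord i)) //.
- move=> j jl; rewrite (muE (Ordinal jl)) -nu_n (bigD1 (Ordinal jl)) //=.
  by rewrite lerDl sumr_ge0.
- by move=> j ji; have jl := ltn_trans ji (ltn_ord i);
    rewrite (muE (Ordinal jl)) nuj.
- by rewrite muE.
Qed.

Lemma sum_beta_sub w : \sum_i (beta l lam - vperm w (rho l)) i = n%:Z.
Proof.
rewrite (eq_bigr (fun i => beta l lam i - rho l (w i))) => [|i _]; last first.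
  by rewrite vecBE vpermE.
rewrite sumrB; have <- : \sum_i rho l i = \sum_i rho l (w i).
  by rewrite [LHS](reindex_inj (@perm_inj _ w)).
rewrite -sumrB -lam_n (big_morph Posz PoszD (erefl _)).
by apply: eq_bigr => i _; rewrite !betaE; lia.
Qed.

Lemma frob_cf_norm : '[frob_cf n (beta l lam)] = 1.
Proof.
rewrite {2}/frob_cf cfdot_sumr (bigD1 1%g) //= odd_perm1 scale1r beta_sub_rho.
rewrite cfdot_frob_shape big1 ?addr0 // => w w1.
by rewrite cfdotZr cfdot_frob_lex ?mulr0 ?sum_beta_sub //; apply: lex_gt_perm.
Qed.

End Norm.

(** * Tableaux *)

Section Tableau.

Variables (n : nat) (lam : seq nat).
Hypotheses (lam_part : is_partition n lam).
Local Notation l := (size lam).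

Lemma part_sumn : sumn lam = n.
Proof. by case/and3P: lam_part => _ _ /eqP. Qed.

Lemma part_noninc i : (row_len lam i.+1 <= row_len lam i)%N.
Proof.
case/and3P: lam_part => lam_s _ _; rewrite /row_len.
have [il|li] := ltnP i.+1 l; last by rewrite nth_default.
by have := sortedP 0%N lam_s; apply.
Qed.

Lemma part_antimono i j : (i <= j)%N -> (row_len lam j <= row_len lam i)%N.
Proof.
elim: j => [|j IHj]; first by rewrite leqn0 => /eqP ->.
rewrite leq_eqVlt => /orP[/eqP -> // | /IHj]; apply: leq_trans.
exact: part_noninc.
Qed.

Lemma row_len_size : row_len lam l = 0%N.
Proof. by rewrite /row_len nth_default. Qed.

Lemma sum_row_len : (\sum_(i < l) row_len lam i)%N = n.
Proof. by rewrite -part_sumn sumnE (big_nth 0%N) big_mkord. Qed.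

Lemma tab_row_lt (k : 'I_n) : (reshape_index lam k < l)%N.
Proof. by rewrite reshape_indexP // part_sumn. Qed.

Definition tab_row : {ffun 'I_n -> 'I_l} := [ffun k => Ordinal (tab_row_lt k)].

Lemma tab_rowE k : tab_row k = reshape_index lam k :> nat.
Proof. by rewrite ffunE. Qed.

Local Notation tab_col k := (reshape_offset lam (nat_of_ord k)).

Lemma tab_col_lt (k : 'I_n) : (tab_col k < row_len lam (tab_row k))%N.
Proof. by rewrite tab_rowE reshape_offsetP // part_sumn. Qed.

Lemma flatten_index_lt r c :
  (c < row_len lam r)%N -> (flatten_index lam r c < n)%N.
Proof.
rewrite -part_sumn /row_len /flatten_index; elim: lam r => [|a s IHs] [|r] //=.
- by rewrite add0n => /leq_trans -> //; apply: leq_addr.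
- by move=> cr; rewrite -addnA ltn_add2l IHs.
Qed.

Lemma tab_cell r c : (c < row_len lam r)%N ->
  exists2 k : 'I_n, tab_row k = r :> nat & tab_col k = c.
Proof.
move=> cr; exists (Ordinal (flatten_index_lt cr)).
  by rewrite tab_rowE /= flatten_indexKl.
by rewrite /= flatten_indexKr.
Qed.

Lemma tab_inj (k k' : 'I_n) :
  tab_row k = tab_row k' -> tab_col k = tab_col k' -> k = k'.
Proof.
move=> er ec; apply: val_inj; rewrite /= -(reshape_indexK lam k).
by rewrite -(reshape_indexK lam k') ec -!tab_rowE er.
Qed.

Lemma weight_tab_row : weight tab_row = [ffun i : 'I_l => (row_len lam i)%:Z].
Proof.
apply/ffunP=> i; rewrite vec_ofE fiber_cardE [RHS]ffunE; congr (_%:Z).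
pose cell (c : 'I_(row_len lam i)) := Ordinal (flatten_index_lt (ltn_ord c)).
have cell_inj : injective cell.
  move=> c d /(congr1 (fun k : 'I_n => tab_col k)) /=.
  by rewrite !flatten_indexKr ?ltn_ord // => /val_inj.
rewrite -[RHS]card_ord -(card_imset _ cell_inj); apply: eq_card => k.
rewrite inE; apply/eqP/imsetP=> [ki|[c _ ->]].
  have kc : (tab_col k < row_len lam i)%N by rewrite -ki tab_col_lt.
  exists (Ordinal kc) => //; apply: val_inj => /=.
  by rewrite -ki tab_rowE reshape_indexK.
by apply: val_inj; rewrite /= tab_rowE /= flatten_indexKl ?ltn_ord.
Qed.

Lemma row_stabE : row_stab n lam = [set p | precomp p tab_row == tab_row].
Proof.
apply/setP=> p; rewrite !inE; apply/forallP/eqP=> [e|/ffunP e k].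
  by apply/ffunP=> k; apply: val_inj; rewrite /= ffunE !tab_rowE; apply/eqP.
by have := e k; rewrite ffunE => /(congr1 val) /=; rewrite !tab_rowE => ->.
Qed.

Lemma col_stabE p : (p \in col_stab n lam) =
  [forall k, tab_col (p k) == tab_col k].
Proof. by rewrite inE. Qed.

Lemma sum_weight_le (f : {ffun 'I_n -> 'I_l}) (i : 'I_l) :
  \sum_(j < l | (j <= i)%N) weight f j = #|[set k | (f k <= i)%N]|%:Z.
Proof.
rewrite -sum1dep_card (partition_big f (fun j : 'I_l => (j <= i)%N)) //=.
rewrite (big_morph Posz PoszD (erefl _)); apply: eq_bigr => j ji.
rewrite vec_ofE fiber_cardE -sum1dep_card; congr (_%:Z).
by apply: eq_bigl => k; case: eqP => [->|]; rewrite ?ji // andbF.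
Qed.

(* Entries distinct along the columns would put at most [min (i + 1) c] entries
   [<= i] in a column of length [c]; [tab_row] attains this bound. *)
Lemma lex_gt_column (f : {ffun 'I_n -> 'I_l}) :
  lex_gt (row_len lam) (weight f) ->
  exists k k' : 'I_n, [/\ k != k', tab_col k = tab_col k' & f k = f k'].
Proof.
case=> i [wj wi].
suff : [exists k : 'I_n, [exists k' : 'I_n,
    [&& k != k', tab_col k == tab_col k' & f k == f k']]].
  case/existsP=> k /existsP[k' /and3P[kk' /eqP ec /eqP ef]].
  by exists k, k'.
apply: contraT => no_pair.
have f_inj (k k' : 'I_n) : tab_col k = tab_col k' -> f k = f k' -> k = k'.
  move=> ec ef; apply/eqP; apply: contraNT no_pair => kk'.
  by apply/existsP; exists k; apply/existsP; exists k'; rewrite kk' ec ef !eqxx.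
have : (#|[set k | (f k <= i)%N]| <= #|[set k | (tab_row k <= i)%N]|)%N.
  have col_lt (k : 'I_n) : (tab_col k < n.+1)%N.
    by rewrite ltnS (leq_trans (leq_subr _ _)) // ltnW.
  pose col k := Ordinal (col_lt k).
  rewrite -!sum1dep_card (partition_big col predT) //=.
  rewrite [leqRHS](partition_big col predT) //=; apply: leq_sum => j _.
  rewrite !sum1dep_card.
  (* If row [i] reaches column [j], this column has a cell in each of the rows 0, ..., i, while [f],
     being injective on it, takes values [<= i] at most [i.+1] times. *)
  have [ji|ij] := ltnP j (row_len lam i).
    have cell (r : 'I_i.+1) : exists k : 'I_n,
        (tab_row k == r :> nat) && (tab_col k == j).
      have [k /eqP kr /eqP kc] := @tab_cell r j
        (leq_trans ji (part_antimono (leq_ord r))).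
      by exists k; rewrite kr kc.
    pose g r := xchoose (cell r).
    have gP r : tab_row (g r) = r :> nat /\ tab_col (g r) = j.
      by have /andP[/eqP -> /eqP ->] := xchooseP (cell r).
    apply: (@leq_trans i.+1).
      have fi k :
          k \in [set k | (f k <= i)%N && (col k == j)] -> (f k < i.+1)%N.
        by rewrite inE => /andP[].
      rewrite -[leqRHS]card_ord.
      pose h k : 'I_i.+1 := inord (f k).
      rewrite -(@card_in_imset _ _ h); first exact: max_card.
      move=> k k' Ak Ak' /(congr1 val); rewrite /= !inordK ?fi // => /val_inj.
      apply: f_inj; move: Ak Ak'.
      rewrite !inE => /andP[_ /eqP e] /andP[_ /eqP e'].
      exact: (congr1 val (etrans e (esym e'))).
    rewrite -[i.+1]card_ord -(card_imset predT (f := g)).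
      apply: subset_leq_card; apply/subsetP=> _ /imsetP[r _ ->].
      rewrite inE -val_eqE /=; have [-> ->] := gP r.
      by rewrite eqxx andbT -ltnS ltn_ord.
    move=> r r' e; apply: val_inj; have [e1 _] := gP r; have [e2 _] := gP r'.
    by rewrite /= -e1 -e2 e.
  (* Otherwise all cells of column [j] lie in rows [<= i]. *)
  apply: subset_leq_card; apply/subsetP=> k; rewrite !inE => /andP[_ /eqP kj].
  rewrite kj eqxx andbT leqNgt; apply/negP=> ik.
  have := tab_col_lt k; rewrite (congr1 val kj : tab_col k = j) ltnNge.
  by rewrite (leq_trans (part_antimono (ltnW ik))).
(* The partial sums up to [i] of the two weights compare the opposite way: they agree before [i],
   and [weight f] is larger at [i]. *)
rewrite -lez_nat -!sum_weight_le leNgt => /negP[].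
rewrite weight_tab_row (bigD1 i) //= [ltRHS](bigD1 i) //= ffunE ltr_leD //.
apply: ler_sum => j /andP[ji ij]; rewrite ffunE wj //.
by rewrite ltn_neqAle ij.
Qed.

End Tableau.

(** * Specht modules *)

(** By Maschke's theorem the image of the embedding has an invariant complement, whose character is
    [c]. *)
Lemma cfRepr_embed (gT : finGroupType) (G : {group gT}) n1 n2
    (rU : mx_representation algC G n1) (rM : mx_representation algC G n2)
    (f : 'M[algC]_(n1, n2)) :
    row_free f -> {in G, forall x, f *m rM x = rU x *m f} ->
  exists2 c : 'CF(G), c \is a character & cfRepr rM = cfRepr rU + c.
Proof.
move=> f_free fJ; pose V := <<f>>%MS.
have fV : (f <= V)%MS by rewrite genmxE.
have modV : mxmodule rM V.
  apply/mxmoduleP=> x Gx; rewrite (eqmxMr _ (genmxE f)) genmxE fJ //.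
  exact: submxMl.
have [W modW VW dxVW] := mx_Maschke_pchar rM (algC'G_pchar G) modV (submx1 V).
have simV : mx_rsim rU (submod_repr modV).
  exists (in_submod V f).
  - by rewrite genmxE; apply/esym/eqP.
  - by rewrite /row_free mxrank_in_submod.
  move=> x Gx; rewrite -in_submodJ // fJ //.
  by rewrite in_submodE [in RHS]in_submodE mulmxA.
exists (cfRepr (submod_repr modW)); first exact: cfRepr_char.
rewrite (cfRepr_sim simV); apply/cfun_inP=> x Gx; rewrite !cfunE Gx !mulr1n.
rewrite (mxtrace_dadd_mod modV modW (mxmodule1 rM) VW dxVW) //.
by rewrite (mxtrace_submod1 (mxmodule1 rM) (eqmx_refl _)).
Qed.

Section CyclicModule.

Variables (F : fieldType) (gT : finGroupType) (G : {group gT}) (n : nat).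
Variables (rG : mx_representation F G n) (v : 'rV[F]_n).

(** The rows of the cyclic module are linear combinations of the translates [v *m rG x]. *)
Lemma cyclic_mx_annihilated m (M : 'M[F]_(n, m)) :
  {in G, forall x, v *m rG x *m M = 0} -> cyclic_mx rG v *m M = 0.
Proof.
move=> vM; apply/row_matrixP=> i; rewrite row_mul row0.
have [A /submxP[a] + ->] :=
  @cyclic_mxP _ _ _ _ rG v _ (row_sub i (cyclic_mx rG v)).
move/(congr1 vec_mx); rewrite mxvecK mulmx_sum_row linear_sum /= => ->.
rewrite mulmx_sumr mulmx_suml big1 // => j _.
by rewrite linearZ rowK /= mxvecK -scalemxAr -scalemxAl vM ?enum_valP ?scaler0.
Qed.

End CyclicModule.

Section SpechtModule.

Variables (n : nat) (lam : seq nat).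
Hypotheses (lam_part : is_partition n lam).
Local Notation l := (size lam).
Local Notation G := [set: 'S_n]%G.
Local Notation aG := (regular_repr algC G).
Local Notation v := (young_symmetrizer n lam).
Local Notation f0 := (tab_row lam_part).

Definition gvec (x : 'S_n) : 'rV[algC]_(gcard G) := gring_row (aG x).

Lemma gvecM x y : gvec x *m aG y = gvec (x * y)%g.
Proof. by rewrite /gvec -gring_row_mul repr_mxM ?inE. Qed.

Lemma gvecE x y : gvec x 0 (gring_index G y) = (y == x)%:R.
Proof.
rewrite /gvec /gring_row rowK gring_indexK ?inE // mul1g mxE eqxx /=.
by rewrite (inj_in_eq (can_in_inj (@gring_indexK _ G))) ?inE.
Qed.

Lemma young_symmetrizerJ x : v *m aG x =
  \sum_(p in row_stab n lam) \sum_(q in col_stab n lam)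
    (-1) ^+ odd_perm q *: gvec (p * q * x)%g.
Proof.
rewrite mulmx_suml; apply: eq_bigr => p _; rewrite mulmx_suml.
by apply: eq_bigr => q _; rewrite -scalemxAl -/(gvec _) gvecM.
Qed.

(* If [f] takes the same value at two entries of a column of the tableau moved
   by [x], the transposition [t] of these entries gives a sign change. *)
Lemma specht_stab_eq0 (f : {ffun 'I_n -> 'I_l}) :
    lex_gt (row_len lam) (weight f) ->
  specht_mx n lam *m (\sum_(s | precomp s f == f) aG s) = 0.
Proof.
move=> lex_f; apply: cyclic_mx_annihilated => x _.
have := lex_f; rewrite -(weight_precomp x) => /(lex_gt_column lam_part).
case=> k [k' [kk' ck]]; rewrite !ffunE => fk.
pose t := tperm k k'; have t_odd : odd_perm t by rewrite odd_tperm.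
have tt : (t * t = 1)%g by apply: tperm2.
have tC q : (q * t \in col_stab n lam)%g = (q \in col_stab n lam).
  rewrite !inE; apply: eq_forallb => i; rewrite permM; congr (_ == _).
  by rewrite /t; case: tpermP => [->|->|].
have tS s : (precomp (t ^ x * s) f == f) = (precomp s f == f).
  rewrite precompM -[X in _ == X](_ : precomp (t ^ x) f = f).
    by rewrite (can_eq (precompK _)).
  apply/ffunP=> i; rewrite ffunE tpermJ.
  by case: tpermP => [->|->|].
rewrite young_symmetrizerJ mulmx_suml big1 // => p _; set S := (X in X = 0).
suff : S = - S.
  move/eqP; rewrite -addr_eq0 -mulr2n -scaler_nat scaler_eq0 pnatr_eq0.
  by move/eqP.
(* Replacing [q] by [q * t] flips the sign, and replacing [s] by [t ^ x * s] restores the group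
   element, since [t * x * t ^ x = x]. *)
rewrite {1}/S (reindex_inj (mulIg t)) /S !mulmx_suml -sumrN.
apply: eq_big => [q|q _]; first exact: tC.
rewrite !mulmx_sumr [LHS](reindex_inj (mulgI (t ^ x)%g)) -sumrN.
apply: eq_big => [s|s _]; first exact: tS.
rewrite -!scalemxAl !gvecM odd_permM t_odd addbT signrN scaleNr.
congr (- (_ *: gvec _)); rewrite conjgE !mulgA mulgK -!mulgA.
congr (_ * (_ * _))%g.
by rewrite (mulgA t t) tt mul1g.
Qed.

(** Up to the factor 1/n!, the inner product sums, over the functions [f] of weight [nu], the trace
    on the Specht module of the sum of the stabiliser of [f]; that sum acts as 0 by
    [specht_stab_eq0]. *)
Lemma cfdot_specht_lex (nu : {ffun 'I_l -> int}) : lex_gt (row_len lam) nu ->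
  '[specht_char n lam, cfRepr (weight_repr n nu)] = 0.
Proof.
move=> lex_nu; rewrite cfdotE.
suff -> :
    \sum_(s in G) specht_char n lam s * (cfRepr (weight_repr n nu) s)^* = 0.
  by rewrite mulr0.
transitivity (\sum_(s : 'S_n) \sum_(f : {ffun 'I_n -> 'I_l} |
    (precomp s f == f) && (weight f == nu)) specht_char n lam s).
  apply: eq_big => s; rewrite ?inE // => _.
  by rewrite weight_charE conjC_nat mulr_natr sumr_const /nfixed cardsE.
rewrite (exchange_big_dep (fun f => weight f == nu)) /=; last first.
  by move=> s f _ /andP[].
apply: big1 => f /eqP fnu.
transitivity (\tr (\sum_(s | precomp s f == f) specht_repr n lam s)).
  rewrite raddf_sum; apply: eq_big => s; first by rewrite fnu eqxx andbT.
  by rewrite cfunE in_setT mulr1n.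
suff -> : \sum_(s | precomp s f == f) specht_repr n lam s = 0.
  by rewrite mxtrace0.
apply: (@val_submod_inj _ _ (specht_mx n lam)); rewrite linear_sum linear0 /=.
rewrite (eq_bigr (fun s => val_submod 1%:M *m aG s)) => [|s _]; last first.
  by rewrite -[specht_repr n lam s]mul1mx val_submodJ ?inE.
rewrite -mulmx_sumr; apply/eqP; rewrite -submx0.
have := val_submodP (1%:M : 'M_(\rank (specht_mx n lam))).
move/(submxMr (\sum_(s | precomp s f == f) aG s))/submx_trans; apply.
by rewrite specht_stab_eq0 ?sub0mx // fnu.
Qed.

(* The intertwining map sending the group element [x] to [f0 . x]. *)
Definition tab_mx : 'M[algC]_(gcard G, #|weight_set n (weight f0)|) :=
  \matrix_(i, j) (enum_val j == precomp (enum_val i)^-1 f0)%:R.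

(** On row vectors, [weight_mx] at [s] sends the basis vector of [f] to that of [precomp s^-1 f];
    this accounts for the inverse in [tab_mx]. *)
Lemma tab_mxJ s : tab_mx *m weight_repr n (weight f0) s = aG s *m tab_mx.
Proof.
apply/row_matrixP=> i; rewrite [RHS]row_mul rowK -rowE; apply/rowP=> j.
have fi : precomp (enum_val i)^-1 f0 \in weight_set n (weight f0).
  by rewrite inE weight_precomp.
rewrite !mxE gring_indexK ?inE //.
rewrite (bigD1 (enum_rank_in fi (precomp (enum_val i)^-1 f0))) //=.
rewrite !mxE enum_rankK_in // eqxx mul1r big1 ?addr0 => [|k ki]; last first.
  rewrite !mxE; case: eqP => [e|_]; last by rewrite mul0r.
  by case/eqP: ki; apply: enum_val_inj; rewrite enum_rankK_in.
rewrite invMg precompM; congr (nat_of_bool _)%:R.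
by rewrite -[RHS](can_eq (precompK s)) precompKV eq_sym.
Qed.

(** Elements [x] and [y] have the same image under [tab_mx] exactly when [y * x^-1] stabilises the
    rows. *)
Lemma gvec_tab_mxK x :
  gvec x *m (tab_mx *m tab_mx^T) = \sum_(r in row_stab n lam) gvec (r * x)%g.
Proof.
apply/rowP=> i; rewrite -[i]gring_valK; set y := enum_val i.
rewrite summxE (eq_bigr _ (fun r _ => gvecE (r * x)%g y)).
have fx : precomp x^-1 f0 \in weight_set n (weight f0).
  by rewrite inE weight_precomp.
rewrite mulmxA /gvec /gring_row rowK gring_indexK ?inE // mul1g -rowE mxE.
rewrite (bigD1 (enum_rank_in fx (precomp x^-1 f0))) //= !mxE.
rewrite !gring_indexK ?inE // enum_rankK_in // eqxx mul1r.
rewrite big1 ?addr0 => [|k kx]; last first.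
  rewrite !mxE gring_indexK ?inE //; case: eqP => [e|_]; last by rewrite mul0r.
  by case/eqP: kx; apply: enum_val_inj; rewrite enum_rankK_in.
rewrite -[LHS]/((precomp x^-1 f0 == precomp y^-1 f0)%:R).
have -> : (precomp x^-1 f0 == precomp y^-1 f0) =
          (y * x^-1 \in row_stab n lam)%g.
  rewrite (row_stabE lam_part) inE precompM -[RHS](can_eq (precompK y^-1)).
  by rewrite precompK.
have [Ryx|Ryx] := boolP (_ \in _).
  rewrite (bigD1 (y * x^-1)%g) //= mulgKV eqxx big1 ?addr0 // => r /andP[_ ryx].
  by case: eqP => // e; case/eqP: ryx; rewrite e mulgK.
rewrite big1 // => r Rr; case: eqP => // e; case/negP: Ryx.
by rewrite e mulgK.
Qed.

(** Left multiplication by a row stabiliser element only permutes the terms of the Young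
    symmetrizer, so each of these elements contributes one copy. *)
Lemma specht_tab_mxK :
  specht_mx n lam *m (tab_mx *m tab_mx^T) =
  #|row_stab n lam|%:R *: specht_mx n lam.
Proof.
apply/eqP; rewrite -subr_eq0 -mul_mx_scalar -mulmxBr; apply/eqP.
apply: cyclic_mx_annihilated => x _; apply/eqP.
rewrite mulmxBr subr_eq0 mul_mx_scalar young_symmetrizerJ; apply/eqP.
have RM r p : r \in row_stab n lam ->
    (r * p \in row_stab n lam)%g = (p \in row_stab n lam).
  rewrite !(row_stabE lam_part) !inE => /eqP rf.
  by rewrite precompM -[X in _ == X]rf (can_eq (precompK _)).
transitivity (\sum_(r in row_stab n lam) \sum_(p in row_stab n lam)
   \sum_(q in col_stab n lam) (-1) ^+ odd_perm q *: gvec (r * p * q * x)%g).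
  rewrite mulmx_suml exchange_big /=; apply: eq_bigr => p _.
  rewrite mulmx_suml exchange_big /=; apply: eq_bigr => q _.
  rewrite -scalemxAl gvec_tab_mxK scaler_sumr; apply: eq_bigr => r _.
  by rewrite !mulgA.
rewrite scaler_nat -sumr_const; apply: eq_bigr => r Rr.
by rewrite [RHS](reindex_inj (mulgI r)); apply: eq_bigl => p; rewrite /= RM.
Qed.

(** On the Specht module the transpose undoes [tab_mx] up to the nonzero scalar [#|row_stab n lam|],
    so [tab_mx] embeds it into the permutation module. *)
Lemma specht_char_summand : exists2 c : 'CF(G), c \is a character &
  cfRepr (weight_repr n (weight f0)) = specht_char n lam + c.
Proof.
pose B := val_submod (1%:M : 'M_(\rank (specht_mx n lam))).
apply: (@cfRepr_embed _ _ _ _ _ _ (B *m tab_mx)); last first.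
  move=> s _; rewrite -mulmxA tab_mxJ [LHS]mulmxA [RHS]mulmxA; congr (_ *m _).
  rewrite [RHS](_ : _ = val_submod (specht_repr n lam s)).
    by rewrite -[specht_repr n lam s]mul1mx val_submodJ ?inE.
  by rewrite /B -val_submodE.
have R0 : #|row_stab n lam|%:R != 0 :> algC.
  rewrite pnatr_eq0 -lt0n; apply/card_gt0P; exists 1%g.
  by rewrite inE; apply/forallP=> k; rewrite perm1.
have BK : B *m tab_mx *m tab_mx^T = #|row_stab n lam|%:R *: B.
  have /submxP[D BD] := val_submodP (1%:M : 'M_(\rank (specht_mx n lam))).
  rewrite (BD : B = _).
  by rewrite -!mulmxA specht_tab_mxK scalemxAr.
rewrite /row_free eqn_leq rank_leq_row /=.
apply: leq_trans (mxrankM_maxl _ tab_mx^T).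
by rewrite BK mxrank_scale_nz // /B val_submod1.
Qed.

(** The coefficient of the identity is 1: row and column stabilisers meet trivially, so [p * q = 1]
    only for [p = q = 1]. *)
Lemma young_symmetrizer_neq0 : v != 0.
Proof.
apply/eqP=> /rowP/(_ (gring_index G 1%g)); rewrite [in RHS]mxE => /eqP.
have {1}-> : v = v *m aG 1%g by rewrite repr_mx1 mulmx1.
rewrite young_symmetrizerJ summxE (bigD1 1%g) /=; last first.
  by rewrite inE; apply/forallP=> k; rewrite perm1.
rewrite summxE (bigD1 1%g) /=; last first.
  by rewrite inE; apply/forallP=> k; rewrite perm1.
rewrite mxE gvecE !mul1g eqxx odd_perm1 mulr1 !big1 ?addr0 ?oner_eq0 //.
  move=> p /andP[Rp p1]; rewrite summxE big1 // => q Cq.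
  rewrite mxE gvecE mulg1; case: eqP => [pq|]; last by rewrite mulr0.
  case/eqP: p1; apply/permP=> k; rewrite perm1.
  apply: (@tab_inj n lam lam_part (p k) k).
    move: Rp; rewrite (row_stabE lam_part) inE => /eqP/ffunP/(_ k).
    by rewrite ffunE.
  move: Cq; rewrite col_stabE => /forallP/(_ (p k))/eqP <-.
  by rewrite -permM -pq perm1.
move=> q /andP[_ q1]; rewrite mxE gvecE mul1g mulg1 eq_sym (negbTE q1).
by rewrite mulr0.
Qed.

Lemma specht_char_neq0 : specht_char n lam != 0.
Proof.
apply/eqP=> /cfunP/(_ 1%g)/eqP; rewrite cfRepr1 cfunE pnatr_eq0 mxrank_eq0.
by rewrite cyclic_mx_eq0 (negbTE young_symmetrizer_neq0).
Qed.

End SpechtModule.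

(** * Frobenius' formula for the Specht character *)

Section SpechtFrobenius.

Variables (n : nat) (lam : seq nat).
Hypotheses (n_gt0 : (0 < n)%N) (lam_part : is_partition n lam).
Local Notation l := (size lam).
Local Notation psi := (frob_cf n (beta l (row_len lam))).
Local Notation eta := (cfRepr (weight_repr n (weight (tab_row lam_part)))).

Lemma size_part_gt0 : (0 < l)%N.
Proof. by case: lam lam_part n_gt0 => // /and3P[_ _ /eqP <-]. Qed.

Lemma specht_charE : specht_char n lam = psi.
Proof.
have l_gt0 := size_part_gt0; have lam_ni := part_noninc lam_part.
have lam_l := row_len_size lam; have lam_n := sum_row_len lam_part.
have psi1 : '[psi] = 1 by apply: frob_cf_norm.
have psi_eta : '[psi, eta] = 1.
  by rewrite weight_tab_row; apply: cfdot_frob_shape.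
have psi_chi : '[psi, specht_char n lam] = '[eta, specht_char n lam].
  rewrite {1}/frob_cf cfdot_suml (bigD1 1%g) //= odd_perm1 scale1r.
  rewrite beta_sub_rho -(weight_tab_row lam_part) big1 ?addr0 // => w w1.
  rewrite cfdotZl cfdotC cfdot_specht_lex ?conjC0 ?mulr0 //.
  exact: lex_gt_perm.
have [c c_char eta_c] := specht_char_summand lam_part.
set chi := specht_char n lam in psi_chi eta_c *.
have chi_char : chi \is a character by apply: cfRepr_char.
have chi_ge1 : 1 <= '[chi].
  have := Cnat_cfdot_char chi_char chi_char => /natrP[k ek].
  rewrite ek ler1n lt0n; apply: contraNneq (specht_char_neq0 lam_part) => k0.
  by rewrite -cfnorm_eq0 ek k0.
have c_chi_ge0 : 0 <= '[c, chi] by apply/natr_ge0/Cnat_cfdot_char.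
have [b [i psi_i]] :=
  vchar_norm1P (frob_cf_vchar n (beta l (row_len lam))) psi1.
have i_chi : 0 <= '['chi_i, chi].
  by apply/natr_ge0/Cnat_cfdot_char => //; apply: irr_char.
have i_c : 0 <= '['chi_i, c].
  by apply/natr_ge0/Cnat_cfdot_char => //; apply: irr_char.
have eta_chi : '[eta, chi] = '[chi] + '[c, chi] by rewrite eta_c cfdotDl.
(* With a minus sign, ['[psi, chi] = '[eta, chi] >= 1] would make ['['chi_i, chi]] negative. *)
have b0 : b = false.
  case: b psi_i => // psi_i; move: psi_chi.
  rewrite psi_i scaleN1r cfdotNl eta_chi => e; suff : 1 <= - '['chi_i, chi].
    by rewrite lerNr => /(le_trans i_chi); rewrite lerNr oppr0 ler10.
  by rewrite e (le_trans chi_ge1) // lerDl.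
move: psi_i; rewrite b0 scale1r => psi_i.
rewrite psi_i in psi_chi psi_eta psi1 *.
(* From here on, 1 <= <chi, chi> <= <eta, chi> = <psi, chi> <= <psi, eta> = 1 forces equality
   throughout, so [chi - psi] has norm 0. *)
have chi_le1 : '['chi_i, chi] <= 1 by rewrite -psi_eta eta_c cfdotDr lerDl.
have chi1 : '[chi] = 1.
  apply/le_anti; rewrite chi_ge1 andbT (le_trans _ chi_le1) //.
  by rewrite psi_chi eta_chi lerDl.
have i_chi1 : '['chi_i, chi] = 1.
  apply/le_anti; rewrite chi_le1 /= psi_chi eta_chi (le_trans chi_ge1) //.
  by rewrite lerDl.
apply/eqP; rewrite -subr_eq0 -cfnorm_eq0 cfdotBl !cfdotBr.
by rewrite [X in _ - X - _]cfdotC i_chi1 chi1 psi1 conjC1 !subrr.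
Qed.

End SpechtFrobenius.

(** * The bounds *)

Section Cycles.

Variables (R : numDomainType) (l n : nat) (s : 'S_n).
Local Notation m := (ncycles s).
Local Notation fn := {ffun 'I_n -> 'I_l}.

(** The default 1 keeps the length positive at every index, as [pconv_bound] requires. *)
Definition cycle_len (j : nat) : nat :=
  nth 1%N [seq #|pred_of_set C| | C <- enum (porbits s)] j.

Lemma cycle_lenE (j : 'I_m) : cycle_len j = #|enum_val j|.
Proof.
rewrite /cycle_len (nth_map set0) -?cardE //.
by rewrite -(enum_val_nth set0).
Qed.

Lemma cycle_len_gt0 j : (0 < cycle_len j)%N.
Proof.
have [jm|mj] := ltnP j m; last first.
  by rewrite /cycle_len nth_default // size_map -cardE.
rewrite (cycle_lenE (Ordinal jm)).
have /imsetP[k _ ->] := enum_valP (Ordinal jm).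
by rewrite (cardsD1 k) porbit_id.
Qed.

Lemma mem_porbits (k : 'I_n) : porbit s k \in porbits s.
Proof. exact: imset_f. Qed.

Definition cycle_of (k : 'I_n) : 'I_m :=
  enum_rank_in (mem_porbits k) (porbit s k).

Lemma cycle_ofK k : enum_val (cycle_of k) = porbit s k.
Proof. by rewrite enum_rankK_in ?mem_porbits. Qed.

Lemma cycle_of_eq j k : (cycle_of k == j) = (k \in enum_val j).
Proof.
rewrite -(inj_eq enum_val_inj) cycle_ofK; have /imsetP[i _ ->] := enum_valP j.
by rewrite eq_porbit_mem porbit_sym.
Qed.

Lemma cycle_of_onto j : exists k, cycle_of k == j.
Proof.
have /imsetP[k _ e] := enum_valP j.
by exists k; rewrite cycle_of_eq e porbit_id.
Qed.

Lemma weight_cycles (c : {ffun 'I_m -> 'I_l}) :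
  weight [ffun k => c (cycle_of k)] = \sum_(j < m) unit_vec (cycle_len j) (c j).
Proof.
apply/ffunP=> i; rewrite vec_ofE fiber_cardE sum_ffunE -sum1dep_card.
rewrite (partition_big cycle_of predT) //= (big_morph Posz PoszD (erefl _)).
apply: eq_bigr => j _; rewrite ffunE cycle_lenE; congr (_%:Z).
rewrite -[#|enum_val j|]sum1_card; have [cj|cj] := eqVneq (c j) i.
  rewrite muln1; apply: eq_bigl => k; rewrite ffunE -cycle_of_eq.
  by case: (cycle_of k =P j) => [->|]; rewrite ?andbF // cj eqxx.
rewrite muln0 big_pred0 // => k; rewrite ffunE.
by case: (cycle_of k =P j) => [->|]; rewrite ?andbF // (negbTE cj).
Qed.

Implicit Type b : {ffun 'I_l -> int}.

(** A function is fixed by [s] exactly when it is constant on the cycles of [s]. *)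
Lemma frobenius_cycles b : frobenius R b s =
  \sum_(c : {ffun 'I_m -> 'I_l})
     alternant R (b - \sum_(j < m) unit_vec (cycle_len j) (c j)).
Proof.
pose spread (c : {ffun 'I_m -> 'I_l}) : fn := [ffun k => c (cycle_of k)].
pose gather (f : fn) := [ffun j => f (xchoose (cycle_of_onto j))].
have cycle_s k : cycle_of (s k) = cycle_of k.
  by apply/eqP; rewrite cycle_of_eq cycle_ofK -{1}[s]expg1 mem_porbit.
rewrite /frobenius (reindex_onto spread gather) /=.
  apply: eq_big => [c|c _]; last by rewrite weight_cycles.
  apply/andP; split; apply/eqP/ffunP=> k; rewrite !ffunE ?cycle_s //.
  by rewrite (eqP (xchooseP (cycle_of_onto k))).
move=> f /eqP/ffunP fs; apply/ffunP=> k; rewrite !ffunE.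
set k' := xchoose _; have : cycle_of k' == cycle_of k.
  exact: (xchooseP (cycle_of_onto (cycle_of k))).
rewrite cycle_of_eq cycle_ofK => /porbitP[i ->].
elim: i => [|i IHi]; first by rewrite perm1.
by rewrite expgSr permM; have := fs ((s ^+ i)%g k); rewrite ffunE => ->.
Qed.

Lemma frobenius_pconv b : frobenius R b s = pconv R m cycle_len b.
Proof.
rewrite frobenius_cycles /pconv -sum_ffun_conv; apply: eq_bigl => c.
by apply/esym/forallP.
Qed.

Lemma frobenius_le_size b : `|frobenius R b s| <= l%:R ^+ m.
Proof.
rewrite frobenius_cycles; apply: le_trans (ler_norm_sum _ _ _) _.
apply: (@le_trans _ _ (\sum_(c : {ffun 'I_m -> 'I_l}) 1)).
  by apply: ler_sum => c _; apply: alternant_le1.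
by rewrite sumr_const card_ffun !card_ord natrX.
Qed.

End Cycles.

(** An entry of lambda + rho is at least l exactly when its row [i] contains the diagonal cell (i,
    i). If [d] rows do, the first [d] rows all have length at least [d], so [d] is admissible in
    [diag_len]. *)
Lemma card_beta_ge n lam : is_partition n lam ->
  (#|[set i : 'I_(size lam) | ((size lam)%:Z <= beta _ (row_len lam) i)%R]|
    <= diag_len lam)%N.
Proof.
move=> lam_part; set A := [set i | _].
have AE i : (i \in A) = (i < row_len lam i)%N.
  by rewrite inE betaE; have := ltn_ord i; lia.
have [->|d_gt0] := posnP #|A|; first exact: leq0n.
set d := #|A| in d_gt0 *.
have d_size : (d <= size lam)%N by rewrite -[leqRHS]card_ord max_card.
have d1 : (d.-1 < size lam)%N by rewrite prednK.
(* Pigeonhole: [d] distinct indices cannot all lie below [d.-1]. *)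
have [i Ai di] : exists2 i, i \in A & (d.-1 <= i)%N.
  apply/exists_inP; apply: contraT => /exists_inPn Ad.
  have : (size (map val (enum A)) <= size (iota 0 d.-1))%N.
    apply: uniq_leq_size; first by rewrite (map_inj_uniq val_inj) enum_uniq.
    move=> _ /mapP[i + ->]; rewrite mem_enum => /Ad.
    by rewrite mem_iota -ltnNge.
  by rewrite size_map -cardE size_iota -/d -ltnS prednK // ltnn.
have d_row : (d <= row_len lam d.-1)%N.
  have := part_antimono lam_part di; move: Ai; rewrite AE; lia.
have d_col : (d <= col_len lam d.-1)%N.
  rewrite /col_len -(cat_take_drop d lam) count_cat.
  apply: leq_trans (leq_addr _ _).
  rewrite (_ : count _ _ = size (take d lam)); last first.
    apply/eqP; rewrite -all_count; apply/(all_nthP 0%N) => k.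
    rewrite size_takel // => kd; rewrite nth_take //.
    have kd1 : (k <= d.-1)%N by lia.
    by move: d_row (part_antimono lam_part kd1); rewrite /row_len; lia.
  by rewrite size_takel.
rewrite /diag_len; apply: (@bigop.bigmax_sup_seq _ _ d) => //.
  rewrite mem_index_iota d_gt0 ltnS (leq_trans d_row) // (part_sumn lam_part).
  by rewrite -(sum_row_len lam_part) (bigD1 (Ordinal d1)) //= leq_addr.
by rewrite leq_min d_row.
Qed.

Theorem theorem1p4 (n : nat) (lam : seq nat) (s : {perm 'I_n}) :
  (1 <= n)%N -> is_partition n lam ->
  `|specht_char n lam s| <= (size lam)%:R ^+ ncycles s
  /\ `|specht_char n lam s| <= (2 * diag_len lam)%N%:R ^+ ncycles s.
Proof.
move=> n_gt0 lam_part; rewrite (specht_charE n_gt0 lam_part) frob_cfE.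
split; first exact: frobenius_le_size.
rewrite frobenius_pconv; apply: pconv_bound; first exact: cycle_len_gt0.
exact: (card_beta_ge lam_part).
Qed.
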